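(* Let $G=(B,C)$ be a finite connected $(k,\ell)$-semiregular bipartite graph with girth $g$ and diameter $d$ whose adjacency matrix has exactly $d+1$ distinct eigenvalues. If $g\ge 2d-2$, then $G$ is distance-biregular.
   Context: A $(k,\ell)$-semiregular bipartite graph $G=(B,C)$ is a bipartite graph with parts $B,C$ where every vertex of $B$ has valency $k$ and every vertex of $C$ has valency $\ell$. A graph is distance-biregular if it is a semiregular bipartite graph such that for any vertices $x,y$ and any integers $i,j$, the number of vertices $z$ with $\mathrm{dist}(x,z)=i$ and $\mathrm{dist}(z,y)=j$ depends only on $\mathrm{dist}(x,y)$ and the valency of $x$. *)

(* Defs.v *)
From mathcomp Require Import all_boot all_order all_algebra.

Set Implicit Arguments.
Unset Strict Implicit.
Unset Printing Implicit Defensive.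

Import GRing.Theory Num.Theory.
Local Open Scope nat_scope.

(* A finite graph is a finType of vertices with a boolean adjacency relation. *)

Definition simple_graph (T : finType) (e : rel T) : Prop :=
  symmetric e /\ irreflexive e.

Definition valency (T : finType) (e : rel T) (x : T) : nat :=
  #|[set y | e x y]|.

Definition bipartite (T : finType) (e : rel T) (B C : {set T}) : Prop :=
  [/\ B :|: C = [set: T], [disjoint B & C]
    & forall x y, e x y -> (x \in B) && (y \in C) || (x \in C) && (y \in B)].

Definition semiregular_bipartite (T : finType) (e : rel T) (B C : {set T})
    (k l : nat) : Prop :=
  [/\ simple_graph e, bipartite e B C,
      forall x, x \in B -> valency e x = k
    & forall x, x \in C -> valency e x = l].

Definition connected_graph (T : finType) (e : rel T) : Prop :=
  0 < #|T| /\ forall x y : T, connect e x y.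

Definition walk (T : finType) (e : rel T) (n : nat) (x y : T) : bool :=
  [exists p : n.-tuple T, path e x p && (last x p == y)].

(* The least length of a walk from x to y.  Some shortest walk has length less
   than #|T| when y is reachable from x; otherwise the value is #|T|, which is
   not the distance of any connected pair. *)
Definition dist (T : finType) (e : rel T) (x y : T) : nat :=
  find (fun n => walk e n x y) (iota 0 #|T|).

Definition diameter (T : finType) (e : rel T) : nat :=
  \max_(x : T) \max_(y : T) dist e x y.

(* The size condition excludes the sequences [:: x; y] with x, y adjacent,
   which are accepted by ucycle. *)
Definition graph_cycle (T : finType) (e : rel T) (c : seq T) : Prop :=
  ucycle e c /\ 3 <= size c.

(* None stands for infinite girth: the graph has no cycle. *)
Definition is_girth (T : finType) (e : rel T) (g : option nat) : Prop :=
  match g with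
  | Some m => (exists2 c, graph_cycle e c & size c = m)
              /\ forall c, graph_cycle e c -> m <= size c
  | None => forall c, ~ graph_cycle e c
  end.

Definition girth_geq (g : option nat) (m : nat) : bool :=
  if g is Some n then m <= n else true.

Definition adjacency_mx (F : fieldType) (T : finType) (e : rel T) :
    'M[F]_#|T| :=
  \matrix_(i, j) (e (enum_val i) (enum_val j))%:R%R.

Definition num_distinct_eigenvalues (F : fieldType) (n : nat) (A : 'M[F]_n)
    (m : nat) : Prop :=
  exists s : seq F, [/\ uniq s, size s = m & forall a, (a \in s) = eigenvalue A a].

Definition distance_biregular (T : finType) (e : rel T) (B C : {set T}) :
    Prop :=
  (exists k l : nat, semiregular_bipartite e B C k l) /\
  forall (x y x' y' : T) (i j : nat),
    dist e x y = dist e x' y' -> valency e x = valency e x' ->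
    #|[set z | (dist e x z == i) && (dist e z y == j)]|
    = #|[set z | (dist e x' z == i) && (dist e z y' == j)]|.

(* Main.v *)
(* Let c_h(x, z) be the number of neighbours of z at distance h - 1 from x, where
   h = dist x z.  Counting in two ways shows that G is distance-biregular as soon
   as c_h(x, z) depends only on h and the valency of x.  At h = d all neighbours
   of z are counted, and for h <= d - 2 the girth forces c_h = 1.  For h = d - 1
   the girth makes c_h(x, z) the entry (A^h)_xz.  Let v be the square root of the
   valency, an eigenvector of the adjacency matrix A for sqrt (k l), and let H be
   the monic polynomial of degree d whose roots are the other eigenvalues.  As A
   is diagonalizable and v spans its eigenspace, H(A) is a multiple of v v^T.  By
   parity the entry of H(A) at a pair at distance d - 1 is the coefficient of
   degree d - 1 times the number of walks, and this coefficient is not 0, since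
   otherwise H(A) = 0, while the entry at a pair at distance d is positive. *)

Require Import Defs.
From mathcomp Require Import all_boot all_order all_algebra.
From mathcomp Require Import zify ring.

Set Implicit Arguments.
Unset Strict Implicit.
Unset Printing Implicit Defensive.

Local Open Scope nat_scope.

(** * Distances, walks and girth *)

Section Graph.

Variables (T : finType) (e : rel T).
Hypotheses (e_sym : symmetric e) (e_conn : connected_graph e).

Lemma walkP n x y :
  reflect (exists p, [/\ path e x p, last x p = y & size p = n]) (walk e n x y).
Proof.
apply: (iffP existsP) => [[p /andP[xp /eqP py]]|[p [xp py /eqP sp]]].
  by exists p; rewrite size_tuple.
by exists (Tuple sp); rewrite /= xp py eqxx.
Qed.

Lemma walk0 x y : walk e 0 x y = (x == y).
Proof.
apply/walkP/eqP => [[p [_ py /size0nil p0]]|->]; first by rewrite p0 in py.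
by exists [::].
Qed.

Lemma walkS n x y : walk e n.+1 x y = [exists z, walk e n x z && e z y].
Proof.
apply/walkP/existsP => [[p []]|[z /andP[/walkP[p [xp pz sp]] zy]]].
  case/lastP: p => // p z; rewrite rcons_path last_rcons size_rcons.
  move=> /andP[xp pz] <- [sp]; exists (last x p); rewrite pz andbT.
  by apply/walkP; exists p.
by exists (rcons p y); rewrite rcons_path last_rcons size_rcons xp pz zy sp.
Qed.

Lemma walk_sym n x y : walk e n x y -> walk e n y x.
Proof.
move=> /walkP[p [xp py sp]]; apply/walkP; exists (rev (belast x p)).
rewrite size_rev size_belast -{1}py rev_path (eq_path (e' := e)); last first.
  by move=> u v; rewrite e_sym.
split=> //; case: p py {xp sp} => [|z p] /= py; first by rewrite py.
by rewrite rev_cons last_rcons.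
Qed.

Lemma dist_le n x y : walk e n x y -> dist e x y <= n.
Proof.
move=> xy; rewrite /dist; case: (ltnP n #|T|) => [nT|]; last first.
  by apply: leq_trans; rewrite -{2}(size_iota 0 #|T|) find_size.
rewrite leqNgt; apply/negP => /(before_find 0).
by rewrite nth_iota // add0n xy.
Qed.

(** A walk can be shortened to one without repeated vertices, whose length is below [#|T|]; so the
    range searched by [dist] suffices. *)
Lemma dist_has x y : has (fun n => walk e n x y) (iota 0 #|T|).
Proof.
have /connectP[p xp ->] := e_conn.2 x y.
case/shortenP: xp => p' xp' up' _; apply/hasP; exists (size p').
  rewrite mem_iota add0n; have := max_card (mem (x :: p')).
  by rewrite (card_uniqP up').
by apply/walkP; exists p'.
Qed.

Lemma dist_ltn x y : dist e x y < #|T|.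
Proof. by rewrite -[X in _ < X](size_iota 0) -has_find dist_has. Qed.

Lemma walk_dist x y : walk e (dist e x y) x y.
Proof.
by have := nth_find 0 (dist_has x y); rewrite nth_iota ?add0n // dist_ltn.
Qed.

Lemma dist_eq0 x y : (dist e x y == 0) = (x == y).
Proof.
rewrite -walk0; apply/eqP/idP => [<-|/dist_le]; first exact: walk_dist.
by rewrite leqn0 => /eqP.
Qed.

Lemma dist_sym x y : dist e x y = dist e y x.
Proof. by apply/eqP; rewrite eqn_leq !dist_le // walk_sym // walk_dist. Qed.

Lemma dist_edge x y z : e y z -> dist e x z <= (dist e x y).+1.
Proof.
move=> yz; apply: dist_le; rewrite walkS; apply/existsP; exists y.
by rewrite walk_dist.
Qed.

Lemma dist_pred x z h :
  dist e x z = h.+1 -> exists2 w, e w z & dist e x w = h.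
Proof.
move=> xz; have := walk_dist x z; rewrite xz walkS.
case/existsP=> w /andP[/dist_le xw wz]; exists w => //.
by apply/eqP; rewrite eqn_leq xw -ltnS -xz dist_edge.
Qed.

Lemma dist_max x y : dist e x y <= diameter e.
Proof. exact: leq_trans (leq_bigmax y) (leq_bigmax (F := fun x => \max_y _) x). Qed.

Lemma diameter_attained : exists x y, dist e x y = diameter e.
Proof.
rewrite /diameter.
have [x ->] := eq_bigmax (fun x => \max_(y : T) dist e x y) e_conn.1.
by have [y ->] := eq_bigmax (fun y => dist e x y) e_conn.1; exists x, y.
Qed.

(* A walk from z through w2 and x to w1 avoids the edge z w1; shortening it and
   closing it with that edge gives the cycle. *)
Lemma two_preds_cycle x z w1 w2 h :
    dist e x z = h.+1 -> dist e x w1 = h -> dist e x w2 = h ->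
    e w1 z -> e w2 z -> w1 != w2 ->
  exists2 c, graph_cycle e c & size c <= 2 * h.+1.
Proof.
move=> xz xw1 xw2 w1z w2z w12.
pose e' u v := e u v && ~~ ((u == z) && (v == w1) || (u == w1) && (v == z)).
have e'_sym u v : e' u v = e' v u.
  by rewrite /e' e_sym; congr (_ && ~~ _); rewrite orbC ![(v == _) && _]andbC.
have neqz w : dist e x w <= h -> (w == z) = false.
  by move=> wh; apply/eqP => wz; move: wh; rewrite wz xz ltnn.
(* Geodesics from [x] of length at most [h] never meet [z], so they survive the deletion of the edge
   [z w1]. *)
have geod n : forall w, dist e x w = n -> n <= h ->
    exists q, [/\ path e' x q, last x q = w & size q = n].
  elim: n => [|n IHn] w xw nh.
    by exists [::]; split=> //; apply/eqP; rewrite -dist_eq0 xw.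
  have [v vw xv] := dist_pred xw.
  have [q [xq qv sq]] := IHn v xv (ltnW nh).
  exists (rcons q w); rewrite rcons_path last_rcons size_rcons sq; split=> //.
  by rewrite xq qv /e' vw !neqz ?andbF ?xw ?xv // ltnW.
have [q1 [xq1 q1w sq1]] := geod h w1 xw1 (leqnn h).
have [q2 [xq2 q2w sq2]] := geod h w2 xw2 (leqnn h).
have q2x : last w2 (rev (belast x q2)) = x.
  by case: (q2) q2w => [|u q] /= qw; rewrite ?qw // rev_cons last_rcons.
pose p := w2 :: rev (belast x q2) ++ q1.
have zp : path e' z p.
  rewrite /p /= cat_path q2x xq1 andbT; apply/andP; split.
    by rewrite /e' e_sym w2z eqxx [z == w1]eq_sym neqz ?xw1 // eq_sym (negPf w12).
  by rewrite -q2w rev_path; rewrite (eq_path (e' := e')).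
have pw1 : last z p = w1 by rewrite /p /= last_cat q2x.
have sp : size p = (2 * h).+1.
  by rewrite /p /= size_cat size_rev size_belast sq1 sq2 mul2n addnn.
case/shortenP: zp pw1 => p' zp' up' p'p p'w1.
exists (z :: p'); last first.
  have /uniq_leq_size : uniq p' by case/andP: up'.
  by move=> /(_ p p'p); rewrite sp /=; lia.
split.
  rewrite /ucycle up' andbT /= rcons_path p'w1 w1z andbT.
  by apply: sub_path zp' => u v /andP[].
(* At least three vertices remain: an empty [p'] would give [z = w1], and a single vertex would use
   the deleted edge. *)
case: p' zp' p'w1 {up' p'p} => [|w [|? ?]] //= zp' p'w1.
  by have := neqz w1; rewrite xw1 leqnn p'w1 eqxx => /(_ isT).
by move: zp'; rewrite p'w1 /e' !eqxx andbF.
Qed.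

(** * Predecessors and numbers of walks under a girth bound *)

Definition nbrs_at (x z : T) (j : nat) : nat :=
  #|[set w | e z w && (dist e x w == j)]|.

Lemma nbrs_at_pred_gt0 x z h : dist e x z = h.+1 -> 0 < nbrs_at x z h.
Proof.
move=> /dist_pred[w wz xw]; apply/card_gt0P; exists w.
by rewrite inE e_sym wz xw eqxx.
Qed.

Lemma nbrs_at_pred1 x z h :
    (forall c, graph_cycle e c -> 2 * h.+1 < size c) ->
  dist e x z = h.+1 -> nbrs_at x z h = 1.
Proof.
move=> no_cycle xz; apply/eqP; rewrite eqn_leq nbrs_at_pred_gt0 // andbT.
apply/card_le1P => w1; rewrite inE => /andP[zw1 /eqP xw1] w2.
rewrite !inE; apply/andP/eqP => [[zw2 /eqP xw2]|->]; last by rewrite zw1 xw1.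
apply/eqP/idPn => w12.
have [||c /no_cycle] := two_preds_cycle xz xw2 xw1 _ _ w12.
- by rewrite e_sym.
- by rewrite e_sym.
by rewrite ltnNge => /negP.
Qed.

(** The entry at [x], [y] of the [n]-th power of the adjacency matrix, kept in [nat]. *)
Fixpoint nwalks n (x y : T) : nat :=
  if n is m.+1 then \sum_(z | e z y) nwalks m x z else (x == y).

Lemma nwalks_gt0 n x y : (0 < nwalks n x y) = walk e n x y.
Proof.
elim: n y => [|n IHn] y; first by rewrite walk0 /=; case: eqP.
rewrite walkS /= lt0n sum_nat_eq0 negb_forall; apply: eq_existsb => z.
by rewrite negb_imply -lt0n IHn andbC.
Qed.

Lemma nwalks_eq0 n x y : ~~ walk e n x y -> nwalks n x y = 0.
Proof. by rewrite -nwalks_gt0 -eqn0Ngt => /eqP. Qed.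

Lemma nwalks_pred x z h : dist e x z = h.+1 ->
  nwalks h.+1 x z = \sum_(w | e z w && (dist e x w == h)) nwalks h x w.
Proof.
move=> xz /=; rewrite (bigID (fun w => dist e x w == h)) /= [X in _ + X]big1.
  by rewrite addn0; apply: eq_bigl => w; rewrite e_sym.
move=> w /andP[wz xw]; apply: nwalks_eq0; apply: contra xw => /dist_le xw.
by rewrite eqn_leq xw -ltnS -xz dist_edge.
Qed.

Lemma nwalks_geodesic x z h :
    (forall c, graph_cycle e c -> 2 * h < size c) ->
  dist e x z = h -> nwalks h x z = 1.
Proof.
elim: h z => [|h IHh] z no_cycle xz /=.
  by rewrite -dist_eq0 xz.
rewrite -[X in X = _]/(nwalks h.+1 x z) nwalks_pred //.
under eq_bigr => w /andP[_ /eqP xw].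
  rewrite IHh //; last by move=> c /no_cycle; lia.
  over.
rewrite sum1_card -(nbrs_at_pred1 no_cycle xz); apply: eq_card => w.
by rewrite !inE.
Qed.

(** Each predecessor of [z] is reached by a unique geodesic, although [z] itself may have several
    predecessors. This is how c_h becomes a matrix entry at the distance where the girth no longer
    forces it to be 1. *)
Lemma nwalks_nbrs_at x z h :
    (forall c, graph_cycle e c -> 2 * h < size c) ->
  dist e x z = h.+1 -> nwalks h.+1 x z = nbrs_at x z h.
Proof.
move=> no_cycle xz; rewrite nwalks_pred //.
under eq_bigr => w /andP[_ /eqP xw] do rewrite nwalks_geodesic //.
by rewrite sum1_card; apply: eq_card => w; rewrite !inE.
Qed.

(** * Parity of distances in bipartite graphs *)

Variable B : {set T}.
Hypothesis e_bip : forall x y, e x y -> (y \in B) = ~~ (x \in B).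

Lemma walk_parity n x y : walk e n x y -> (y \in B) = (x \in B) (+) odd n.
Proof.
elim: n y => [|n IHn] y; first by rewrite walk0 addbF => /eqP->.
rewrite walkS => /existsP[z /andP[/IHn xz /e_bip->]] /=.
by rewrite xz addbN.
Qed.

Lemma nwalks_parity n x y :
  odd n != odd (dist e x y) -> nwalks n x y = 0.
Proof.
move=> od; apply: nwalks_eq0; apply: contra od => /walk_parity.
by rewrite (walk_parity (walk_dist x y)) => /addbI->.
Qed.

Lemma dist_edge_cases x y z : e y z ->
  (dist e x z == (dist e x y).+1) || (dist e x y == (dist e x z).+1).
Proof.
move=> yz; have := dist_edge x yz; have := yz; rewrite e_sym => /(dist_edge x).
have: odd (dist e x z) = ~~ odd (dist e x y).
  have := e_bip yz; rewrite (walk_parity (walk_dist x y)).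
  by rewrite (walk_parity (walk_dist x z)) -addbN => /addbI.
case: (ltngtP (dist e x y) (dist e x z)) => [||->]; lia.
Qed.

Lemma nbrs_at_out x z j :
  j != (dist e x z).+1 -> dist e x z != j.+1 -> nbrs_at x z j = 0.
Proof.
move=> /negPf j1 /negPf j2; apply: eq_card0 => w; rewrite !inE; apply/negP.
case/andP=> /(dist_edge_cases x) + /eqP xw; by rewrite xw j1 j2.
Qed.

(** By parity no neighbour of [z] is as far from [x] as [z] is. Hence the outward count is
    determined by c_h and the valency. *)
Lemma nbrs_at_valency x z h :
  dist e x z = h.+1 -> nbrs_at x z h + nbrs_at x z h.+2 = valency e z.
Proof.
move=> xz; rewrite -cardsUI.
rewrite [X in _ + #|pred_of_set X|](_ : _ = set0) ?cards0 ?addn0; last first.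
  by apply/setP => w; rewrite !inE; case: e => //=; lia.
apply: eq_card => w; rewrite !inE -andb_orr; case zw: (e z w) => //=.
by have := dist_edge_cases x zw; rewrite xz eqSS orbC [h == _]eq_sym.
Qed.

End Graph.

(** * Walks of length d - 1 and the spectrum *)

Section Spectral.

Import Order.TTheory GRing.Theory Num.Theory.
Local Open Scope ring_scope.

Variable F : numClosedFieldType.

(** A real symmetric matrix is unitarily diagonalizable, and the polynomial vanishes at every
    diagonal entry. *)
Lemma horner_mx_symmetric_eq0 n (A : 'M[F]_n.+1) (s : seq F) :
    A^T = A -> A \is a realmx -> {subset eigenvalue A <= s} ->
  horner_mx A (\prod_(a <- s) ('X - a%:P)) = 0.
Proof.
move=> A_sym A_real As.
have /orthomx_spectralP AE : A \is normalmx.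
  apply: symmetric_normalmx => //; apply/is_hermitianmxP.
  by rewrite expr0 scale1r map_mx_id // A_sym.
set P := spectralmx A in AE; set D := spectral_diag A in AE.
have P_unit : P \in unitmx := spectral_unit A.
(* Row [i] of [P] is an eigenvector for [D 0 i], nonzero because [P] is invertible. *)
have Ds i : D 0 i \in s.
  apply: As; apply/eigenvalueP; exists (row i P).
    rewrite -row_mul {1}AE !mulmxA mulmxV // mul1mx row_mul row_diag_mx.
    by rewrite -scalemxAl -rowE.
  apply/eqP => Pi0; have /(congr1 (fun M => row i M 0 i)) := mulmxV P_unit.
  by rewrite row_mul Pi0 mul0mx !mxE eqxx => /esym/eqP; rewrite oner_eq0.
rewrite AE horner_mx_uconjC // horner_mx_diag.
suff -> : map_mx (horner (\prod_(a <- s) ('X - a%:P))) D = 0.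
  by rewrite (_ : diag_mx 0 = 0) ?mulmx0 ?mul0mx //; apply/matrixP => i j; rewrite !mxE mul0rn.
apply/matrixP => i j; rewrite !mxE ord1; apply/eqP.
by rewrite -[_ == 0]/(root _ _) root_prod_XsubC.
Qed.

(* The energy [\sum_(x ~ y) v x * v y * `|u x / v x - u y / v y| ^+ 2] of an
   eigenvector u for the same eigenvalue as v vanishes. *)
Lemma positive_eigenvector_simple (T : finType) (e : rel T) (theta : F)
    (u v : T -> F) :
    symmetric e -> connected_graph e -> (forall x, 0 < v x) ->
    (forall x, \sum_(y | e x y) v y = theta * v x) ->
    (forall x, \sum_(y | e x y) u y = theta * u x) ->
  forall x y, u x * v y = u y * v x.
Proof.
move=> e_sym [_ e_conn] v_gt0 vE uE.
have v_neq0 x : v x != 0 by rewrite gt_eqF.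
pose w x := u x / v x.
have wv x : v x * w x = u x by rewrite mulrC divfK.
have w_sum x : \sum_(y | e x y) v y * (w x - w y) = 0.
  under eq_bigr => y _ do rewrite mulrBr wv.
  rewrite sumrB uE -mulr_suml vE -wv; ring.
have energy : \sum_x \sum_(y | e x y) v x * v y * `|w x - w y| ^+ 2 = 0.
  (* Expanding the conjugate factor of the squared norm splits the energy into two sums whose inner
     sums vanish by [w_sum]. *)
  transitivity (\sum_x (v x * (w x)^*) * \sum_(y | e x y) v y * (w x - w y)
     + \sum_y (v y * (w y)^*) * \sum_(x | e y x) v x * (w y - w x)).
    under [X in _ + X]eq_bigr => y _ do rewrite mulr_sumr big_mkcond.
    rewrite exchange_big -big_split /=; apply: eq_bigr => x _.
    rewrite -big_mkcond mulr_sumr (eq_bigl _ _ (fun y => e_sym y x)) -big_split.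
    by apply: eq_bigr => y _ /=; rewrite normCK rmorphB; ring.
  by rewrite !big1 ?addr0 // => x _; rewrite w_sum mulr0.
have w_edge x y : e x y -> w x = w y.
  have term_ge0 z t : 0 <= v z * v t * `|w z - w t| ^+ 2.
    by rewrite !mulr_ge0 ?exprn_ge0 // ltW.
  move=> xy; have /eqP := energy; rewrite psumr_eq0; last first.
    by move=> z _; apply: sumr_ge0.
  move=> /allP/(_ x (mem_index_enum _)); rewrite psumr_eq0 //.
  move=> /allP/(_ y (mem_index_enum _)); rewrite xy.
  by rewrite !mulf_eq0 !(negPf (v_neq0 _)) /= normr_eq0 orbb subr_eq0 => /eqP.
have w_const x y : w x = w y.
  have /connectP[p xp ->] := e_conn x y.
  elim: p x xp => //= z p IHp x /andP[xz /IHp <-]; exact: w_edge.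
by move=> x y; rewrite -(wv x) -(wv y) (w_const x y); ring.
Qed.


Lemma adjacency_mx_expn n (T : finType) (e : rel T) (f : 'I_n.+1 -> T) m i j :
    bijective f ->
  ((\matrix_(i, j) (e (f i) (f j))%:R : 'M[F]_n.+1) ^+ m) i j
  = (nwalks e m (f i) (f j))%:R.
Proof.
move=> f_bij; elim: m j => [|m IHm] j.
  by rewrite expr0 mxE /= (inj_eq (bij_inj f_bij)).
rewrite exprSr mxE /= natr_sum [RHS]big_mkcond [RHS](reindex f) /=; last exact: onW_bij.
by apply: eq_bigr => h _; rewrite IHm mxE; case: (e _ _); rewrite ?mulr1 ?mulr0.
Qed.

Lemma horner_mx_entry n (A : 'M[F]_n.+1) (p : {poly F}) i j :
  horner_mx A p i j = \sum_(m < size p) p`_m * (A ^+ m) i j.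
Proof.
rewrite -{1}[p]coefK poly_def rmorph_sum summxE; apply: eq_bigr => m _.
by rewrite /= horner_mxZ rmorphXn /= horner_mx_X mxE.
Qed.

(** Matrix powers and [horner_mx] are taken at sizes of the form [n.+1], so the index set is moved
    there from [#|T|]. *)
Lemma adjacency_mx_reindex (T : finType) (e : rel T) : (0 < #|T|)%N ->
  exists n (f : 'I_n.+1 -> T), bijective f /\
    forall a, eigenvalue (adjacency_mx F e) a
            = eigenvalue (\matrix_(i, j) (e (f i) (f j))%:R : 'M[F]_n.+1) a.
Proof.
move=> T_gt0; have E : #|T| = #|T|.-1.+1 by rewrite prednK.
exists #|T|.-1, (fun i => enum_val (cast_ord (esym E) i)); split.
  apply: bij_comp; first exact: enum_val_bij.
  by exists (cast_ord E); [exact: cast_ordKV | exact: cast_ordK].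
move=> a; transitivity (eigenvalue (castmx (E, E) (adjacency_mx F e)) a).
  by case: _ / E; rewrite castmx_id.
by congr (eigenvalue _ a); apply/matrixP => i j; rewrite castmxE !mxE.
Qed.

Arguments nwalks : simpl never.

Lemma nwalks_spectral (T : finType) (e : rel T) (B : {set T})
    (theta : F) (v : T -> F) d :
    symmetric e -> connected_graph e ->
    (forall x y, e x y -> (y \in B) = ~~ (x \in B)) ->
    (forall x, 0 < v x) ->
    (forall x, \sum_(y | e x y) v y = theta * v x) ->
    diameter e = d.+1 ->
    num_distinct_eigenvalues (adjacency_mx F e) d.+2 ->
  forall x y x' y', dist e x y = d -> dist e x' y' = d ->
    v x * v y = v x' * v y' -> nwalks e d x y = nwalks e d x' y'.
Proof.
move=> e_sym e_conn e_bip v_gt0 vE diam [s [s_uniq s_size s_eig]].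
have v_neq0 x : v x != 0 by rewrite gt_eqF.
have [n [f [f_bij f_eig]]] := adjacency_mx_reindex e e_conn.1.
set A : 'M[F]_n.+1 := \matrix_(_, _) _ in f_eig.
have As a : (a \in s) = eigenvalue A a by rewrite s_eig f_eig.
have A_sym : A^T = A by apply/matrixP => i j; rewrite !mxE e_sym.
have s_theta : theta \in s.
  rewrite As; apply/eigenvalueP; exists (\row_i v (f i)).
    apply/rowP => j; rewrite !mxE -vE [RHS]big_mkcond [RHS](reindex f) /=; last first.
      exact: onW_bij.
    by apply: eq_bigr => i _; rewrite !mxE e_sym; case: (e _ _); rewrite ?mulr1 ?mulr0.
  apply/eqP => /rowP/(_ 0); rewrite !mxE => /eqP; exact/negP.
(* The polynomial H; its degree is the diameter, which is [d.+1] here. *)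
pose p := \prod_(a <- rem theta s) ('X - a%:P).
have p_size : size p = d.+2 by rewrite size_prod_XsubC size_rem // s_size.
have p_monic : p`_d.+1 = 1.
  have /monicP : p \is monic by apply: monic_prod_XsubC.
  by rewrite lead_coefE p_size.
pose M := horner_mx A p.
have M_theta : M *m A = theta *: M.
  have : horner_mx A (\prod_(a <- s) ('X - a%:P)) = 0.
    apply: horner_mx_symmetric_eq0 => //; last by move=> a; rewrite As.
    by apply/mxOverP => i j; rewrite mxE realn.
  rewrite (perm_big _ (perm_to_rem s_theta)) big_cons /= mulrC rmorphM rmorphB /=.
  rewrite horner_mx_X horner_mx_C mulrBr => /eqP; rewrite subr_eq0 => /eqP.
  by move=> ME; apply: etrans ME _; rewrite -[LHS]/(_ *m _) mul_mx_scalar.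
have M_theta' : A *m M = theta *: M by rewrite -M_theta; exact: comm_mx_horner.
have [g fK gK] := f_bij.
pose N x y := M (g x) (g y).
(* By [M_theta] and [M_theta'] the rows and columns of [M] satisfy the eigenvector equation for
   [theta], so they are multiples of [v]. *)
have N_row x : forall y y', N x y * v y' = N x y' * v y.
  apply: (positive_eigenvector_simple e_sym e_conn v_gt0 vE) => y.
  have /matrixP/(_ (g x) (g y)) := M_theta; rewrite !mxE -/(N x y) => <-.
  rewrite [LHS]big_mkcond [LHS](reindex f) /=; last exact: onW_bij.
  apply: eq_bigr => i _.
  by rewrite /N fK mxE gK e_sym; case: (e _ _); rewrite ?mulr1 ?mulr0.
have N_col y : forall x x', N x y * v x' = N x' y * v x.
  apply: (positive_eigenvector_simple e_sym e_conn v_gt0 vE) => x.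
  have /matrixP/(_ (g x) (g y)) := M_theta'; rewrite !mxE -/(N x y) => <-.
  rewrite [LHS]big_mkcond [LHS](reindex f) /=; last exact: onW_bij.
  apply: eq_bigr => i _.
  by rewrite /N fK mxE gK; case: (e _ _); rewrite ?mul1r ?mul0r.
have N_rank1 x y x' y' : N x y * (v x' * v y') = N x' y' * (v x * v y).
  by rewrite mulrCA mulrC N_row -mulrA [v y * _]mulrC mulrA N_col; ring.
have NE x y : N x y = \sum_(m < d.+2) p`_m * (nwalks e m x y)%:R.
  rewrite /N horner_mx_entry p_size; apply: eq_bigr => m _.
  by rewrite adjacency_mx_expn // !gK.
have N_diam x y : dist e x y = d.+1 -> N x y != 0.
  move=> xy; rewrite NE big_ord_recr big1 /= => [|m _]; last first.
    rewrite nwalks_eq0 ?mulr0 //; apply/negP => /(dist_le).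
    by rewrite xy leqNgt ltn_ord.
  by rewrite p_monic mul1r add0r pnatr_eq0 -lt0n nwalks_gt0 -xy walk_dist.
have N_pred x y : dist e x y = d -> N x y = p`_d * (nwalks e d x y)%:R.
  move=> xy; rewrite NE !big_ord_recr big1 /= => [|m _]; last first.
    rewrite nwalks_eq0 ?mulr0 //; apply/negP => /(dist_le).
    by rewrite xy leqNgt ltn_ord.
  (* The leading term drops out: no walk of length [d.+1] joins vertices at distance [d]. *)
  rewrite add0r (nwalks_parity e_conn e_bip (n := d.+1)) ?mulr0 ?addr0 //.
  by rewrite xy /=; case: odd.
have pd_neq0 x y : dist e x y = d -> p`_d != 0.
  move=> xy; apply/eqP => pd0; have [a [b]] := diameter_attained e_conn.
  rewrite diam => /N_diam/eqP; apply; apply/eqP.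
  have /eqP := N_rank1 a b x y; rewrite (N_pred x y xy) pd0 !mul0r.
  by rewrite !mulf_eq0 !(negPf (v_neq0 _)) !orbF.
move=> x y x' y' xy xy' vv; have := N_rank1 x y x' y'.
rewrite -vv => /mulIf; rewrite mulf_neq0 // => /(_ isT).
rewrite !N_pred // => /mulfI; rewrite (pd_neq0 x y xy) => /(_ isT)/eqP.
by rewrite eqr_nat => /eqP.
Qed.
End Spectral.

(** * From c_h to the intersection numbers *)

Section Counting.

Variables (T : finType) (e : rel T) (B : {set T}).
Hypotheses (e_sym : symmetric e) (e_conn : connected_graph e).
Hypothesis e_bip : forall x y, e x y -> (y \in B) = ~~ (x \in B).
Hypothesis valency_dist : forall x y x' y',
  dist e x y = dist e x' y' -> valency e x = valency e x' ->
  valency e y = valency e y'.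
Hypothesis nbrs_at_dist : forall x z x' z' j,
  dist e x z = dist e x' z' -> valency e x = valency e x' ->
  nbrs_at e x z j = nbrs_at e x' z' j.

Definition sphere_meet (i j : nat) (x y : T) : nat :=
  #|[set z | (dist e x z == i) && (dist e z y == j)]|.

(** By [nbrs_at_dist] the choice of the pair does not matter; the value 0 is a default when no pair
    has this valency and distance. *)
Definition intersection_array (v h j : nat) : nat :=
  if [pick p : T * T | (valency e p.1 == v) && (dist e p.1 p.2 == h)]
  is Some p then nbrs_at e p.1 p.2 j else 0.

Lemma intersection_arrayE x z j :
  nbrs_at e x z j = intersection_array (valency e x) (dist e x z) j.
Proof.
rewrite /intersection_array; case: pickP => [p /andP[/eqP vp /eqP dp]|].
  exact: nbrs_at_dist.
by move=> /(_ (x, z)); rewrite !eqxx.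
Qed.

Lemma intersection_array_out v h j : j.+1 < h -> intersection_array v h j = 0.
Proof.
move=> jh; rewrite /intersection_array; case: pickP => // p /andP[_ /eqP dp].
by apply: (nbrs_at_out e_sym e_conn e_bip); rewrite dp; lia.
Qed.

Lemma sphere_meet_sym i j x y : sphere_meet i j x y = sphere_meet j i y x.
Proof.
by apply: eq_card => z; rewrite !inE andbC !(dist_sym e_sym e_conn z) dist_sym.
Qed.

(** Group the vertices [z] by [h = dist e y z], which is always below [#|T|]. *)
Lemma sum_sphere_meet i j x y :
  \sum_(h < #|T|) sphere_meet i h x y * intersection_array (valency e y) h j
  = \sum_(z | dist e x z == i) nbrs_at e y z j.
Proof.
rewrite (partition_big (fun z => Ordinal (dist_ltn e_conn y z)) xpredT) //=.
apply: eq_bigr => h _; rewrite -sum_nat_const; apply: eq_big => z.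
  by rewrite inE (dist_sym e_sym e_conn z).
by rewrite inE => /andP[_ /eqP <-]; rewrite intersection_arrayE dist_sym.
Qed.

Lemma sum_nbrs_at_exchange i j x y :
  \sum_(z | dist e x z == i) nbrs_at e y z j
  = \sum_(w | dist e y w == j) nbrs_at e x w i.
Proof.
transitivity (\sum_(z | dist e x z == i) \sum_(w | dist e y w == j) e z w).
  apply: eq_bigr => z _; rewrite /nbrs_at -sum1_card big_mkcond [RHS]big_mkcond.
  by apply: eq_bigr => w _; rewrite inE; case: e; case: eqP.
rewrite exchange_big; apply: eq_bigr => w _.
rewrite /nbrs_at -sum1_card big_mkcond [RHS]big_mkcond.
by apply: eq_bigr => z _; rewrite inE e_sym; case: e; case: eqP.
Qed.

(* Counting the edges between the sphere of radius i around x and the sphere of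
   radius j around y in two ways gives a recursion on j. *)
Lemma sphere_meet_dist x y x' y' :
    dist e x y = dist e x' y' -> valency e x = valency e x' ->
  forall j i, sphere_meet i j x y = sphere_meet i j x' y'.
Proof.
move=> dxy vx; have vy := valency_dist dxy vx.
elim/ltn_ind=> -[|j] IH i.
  have E u v : sphere_meet i 0 u v = (dist e u v == i).
    have [uv|uv] := eqVneq (dist e u v) i.
      apply/eqP/cards1P; exists v; apply/setP => z; rewrite !inE.
      rewrite (dist_eq0 e_conn).
      by have [->|_] := eqVneq z v; rewrite ?andbF // uv eqxx.
    apply: eq_card0 => z; rewrite !inE (dist_eq0 e_conn) andbC.
    by have [->|//] := eqVneq z v; exact: negPf.
  by rewrite !E dxy.
case: (ltnP j.+1 #|T|) => [jT|Tj]; last first.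
  have E u v : sphere_meet i j.+1 u v = 0.
    apply: eq_card0 => z; rewrite !inE; apply/negP => /andP[_ /eqP zv].
    by have := dist_ltn e_conn z v; rewrite zv ltnNge Tj.
  by rewrite !E.
(* After the exchange and a swap of the two ends, only intersection numbers with second index [j]
   occur, and the induction hypothesis covers them. *)
have sums : \sum_(h < #|T|) sphere_meet i h x y
      * intersection_array (valency e y) h j
    = \sum_(h < #|T|) sphere_meet i h x' y'
      * intersection_array (valency e y) h j.
  rewrite {2}vy !sum_sphere_meet !(sum_nbrs_at_exchange i) -!sum_sphere_meet vx.
  apply: eq_bigr => h _; congr (_ * _).
  by rewrite !(sphere_meet_sym j) IH.
(* Terms with [h <= j] agree by induction, and those with [h > j.+1] vanish. Only [h = j.+1] is
   left, with the factor c at distance [j.+1]. *)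
have rest : \sum_(h < #|T| | h != Ordinal jT) sphere_meet i h x y
      * intersection_array (valency e y) h j
    = \sum_(h < #|T| | h != Ordinal jT) sphere_meet i h x' y'
      * intersection_array (valency e y) h j.
  apply: eq_bigr => h; rewrite -val_eqE /= => hj.
  case: (ltnP h j.+1) => [hj'|jh]; first by rewrite IH.
  by rewrite intersection_array_out ?muln0 // ltn_neqAle eq_sym hj.
move: sums; rewrite (bigD1 (Ordinal jT)) // [RHS](bigD1 (Ordinal jT)) //= rest.
move/addIn/eqP; rewrite eqn_mul2r => /orP[/eqP K0|/eqP//].
(* If that factor is 0, no vertex is at distance [j.+1] from [v], since it would have a predecessor;
   both numbers are then 0. *)
have E u v : valency e v = valency e y -> sphere_meet i j.+1 u v = 0.
  move=> vv; apply: eq_card0 => z; rewrite !inE; apply/negP => /andP[_ /eqP zv].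
  move: zv; rewrite (dist_sym e_sym e_conn) => zv.
  have := nbrs_at_pred_gt0 e_sym e_conn zv.
  by rewrite intersection_arrayE vv zv K0.
by rewrite !E.
Qed.

End Counting.

(** * Semiregular bipartite graphs *)

Section Semiregular.

Variables (T : finType) (e : rel T) (B C : {set T}) (k l : nat).
Hypotheses (hG : semiregular_bipartite e B C k l) (e_conn : connected_graph e).

Lemma semiregular_sym : symmetric e.
Proof. by case: hG => -[]. Qed.

Lemma bipartite_notin x : (x \in C) = ~~ (x \in B).
Proof.
case: hG => _ [BC BdC _] _ _; have := in_setT x; rewrite -BC inE.
by have /(_ x) := disjointFr BdC; case: (x \in B) => // ->.
Qed.

Lemma bipartite_edge x y : e x y -> (y \in B) = ~~ (x \in B).
Proof.
case: hG => _ [_ _ e_BC] _ _ /e_BC; rewrite !bipartite_notin.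
by case: (x \in B); case: (y \in B).
Qed.

Lemma semiregular_valency x : valency e x = if x \in B then k else l.
Proof.
case: hG => _ _ vB vC; case: ifPn => [/vB//|]; rewrite -bipartite_notin.
exact: vC.
Qed.

(** The parity of the distance tells whether the ends share a side. If [x] and [x'] lie on opposite
    sides, equal valencies force [k = l]. *)
Lemma valency_dist x y x' y' :
  dist e x y = dist e x' y' -> valency e x = valency e x' ->
  valency e y = valency e y'.
Proof.
move=> dxy; rewrite !semiregular_valency.
rewrite (walk_parity bipartite_edge (walk_dist e_conn x y)).
rewrite (walk_parity bipartite_edge (walk_dist e_conn x' y')) dxy.
by case: (x \in B); case: (x' \in B); case: (odd _) => //= ->.
Qed.

Lemma valency_gt0 (x y z : T) : x != y -> 0 < valency e z.
Proof.
move=> xy; have [w wz] : exists w, w != z.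
  by have [<-|xz] := eqVneq x z; [exists y; rewrite eq_sym | exists x].
move: wz; rewrite -(dist_eq0 e_conn); case wz: (dist e w z) => [//|n] _.
have [u uz _] := dist_pred e_conn wz.
by apply/card_gt0P; exists u; rewrite inE semiregular_sym.
Qed.

Lemma nbrs_at_dist1 x z j :
  dist e x z = 0 -> nbrs_at e x z j = if j == 1 then valency e x else 0.
Proof.
move=> xz; have /eqP := xz; rewrite (dist_eq0 e_conn) => /eqP zx.
rewrite -{z}zx in xz *.
case: eqP => [->|/eqP j1]; last first.
  by apply: (nbrs_at_out semiregular_sym e_conn bipartite_edge); rewrite xz.
apply: eq_card => w; rewrite !inE; case xw: (e x w) => //=.
by have := dist_edge_cases semiregular_sym e_conn bipartite_edge x xw; rewrite xz orbF.
Qed.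

Import Order.TTheory GRing.Theory Num.Theory.

(** All neighbours of [x] have the valency of the other side; for [x] in [B] the sum is [k] times
    the root of [l]. *)
Lemma sqrt_valency_eigenvector (F : numClosedFieldType) x :
  (\sum_(y | e x y) sqrtC (valency e y)%:R
   = sqrtC k%:R * sqrtC l%:R * sqrtC (valency e x)%:R :> F)%R.
Proof.
transitivity (\sum_(y | e x y) sqrtC (if x \in B then l else k)%:R : F)%R.
  apply: eq_bigr => y /bipartite_edge xy.
  by rewrite semiregular_valency xy; case: (x \in B).
rewrite sumr_const.
have -> : #|[pred y | e x y]| = valency e x.
  by apply: eq_card => y; rewrite !inE.
rewrite semiregular_valency -[LHS]mulr_natl.
have sq n : (n%:R = sqrtC n%:R * sqrtC n%:R :> F)%R by rewrite -expr2 sqrtCK.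
by case: (x \in B); [rewrite mulrAC -sq | rewrite -mulrA -sq mulrC].
Qed.

Lemma nbrs_at_pred_dist (F : numClosedFieldType) x z x' z' h :
    (forall c, graph_cycle e c -> 2 * diameter e - 2 <= size c) ->
    num_distinct_eigenvalues (adjacency_mx F e) (diameter e + 1) ->
    dist e x z = h.+1 -> dist e x' z' = h.+1 -> valency e x = valency e x' ->
  nbrs_at e x z h = nbrs_at e x' z' h.
Proof.
move=> girth eig xz xz' vx.
have vz : valency e z = valency e z' by apply: valency_dist vx; rewrite xz.
have hd : h < diameter e by rewrite -xz dist_max.
(* The distance is [h.+1], so the cases are distance d, then d - 1, then at most d - 2. *)
have [d1|d1] := eqVneq (diameter e) h.+1.
  have E u v : dist e u v = h.+1 -> nbrs_at e u v h = valency e v.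
    move=> uv.
    rewrite -(nbrs_at_valency semiregular_sym e_conn bipartite_edge uv).
    rewrite [X in _ + X](_ : _ = 0) ?addn0 //; apply: eq_card0 => w.
    rewrite !inE; apply/negP => /andP[_ /eqP uw].
    by have := dist_max e u w; rewrite uw d1 ltnn.
  by rewrite !E.
have [d2|d2] := eqVneq (diameter e) h.+2.
  (* Here 2d - 2 is [2 * h.+1]: cycles of exactly this length are allowed, so only geodesics of
     length [h] are known to be unique. *)
  have short c : graph_cycle e c -> 2 * h < size c by move/girth; lia.
  rewrite -!(nwalks_nbrs_at semiregular_sym e_conn short) //.
  pose v y : F := sqrtC (valency e y)%:R.
  have v_gt0 y : (0 < v y)%R.
    rewrite sqrtC_gt0 ltr0n; apply: (@valency_gt0 x z).
    by rewrite -(dist_eq0 e_conn) xz.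
  apply: (nwalks_spectral semiregular_sym e_conn bipartite_edge v_gt0 _ d2) => //.
  - exact: sqrt_valency_eigenvector.
  - by rewrite -d2 -addn1.
  - by rewrite /v vx vz.
have short c : graph_cycle e c -> 2 * h.+1 < size c by move/girth; lia.
by rewrite !(nbrs_at_pred1 semiregular_sym e_conn short).
Qed.

Lemma nbrs_at_dist (F : numClosedFieldType) x z x' z' j :
    (forall c, graph_cycle e c -> 2 * diameter e - 2 <= size c) ->
    num_distinct_eigenvalues (adjacency_mx F e) (diameter e + 1) ->
    dist e x z = dist e x' z' -> valency e x = valency e x' ->
  nbrs_at e x z j = nbrs_at e x' z' j.
Proof.
move=> girth eig xz vx; case xz': (dist e x' z') => [|h]; rewrite xz' in xz.
  by rewrite !nbrs_at_dist1 // vx.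
have pred := nbrs_at_pred_dist girth eig xz xz' vx.
have [->//|jh] := eqVneq j h.
(* The outward count is the valency of [z] minus the inward one. *)
have [->|jh2] := eqVneq j h.+2.
  apply/(@addnI (nbrs_at e x z h)); rewrite {2}pred.
  rewrite !(nbrs_at_valency semiregular_sym e_conn bipartite_edge) //.
  by apply: valency_dist vx; rewrite xz.
by rewrite !(nbrs_at_out semiregular_sym e_conn bipartite_edge) ?xz ?xz' // eqSS eq_sym.
Qed.

End Semiregular.

Theorem theorem5p2 (F : numClosedFieldType) (T : finType) (e : rel T)
    (B C : {set T}) (k l d : nat) (g : option nat)
    (hG : semiregular_bipartite e B C k l)
    (hconn : connected_graph e)
    (hg : is_girth e g)
    (hd : diameter e = d)
    (heig : num_distinct_eigenvalues (adjacency_mx F e) (d + 1))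
    (hgd : girth_geq g (2 * d - 2)) :
  distance_biregular e B C.
Proof.
split; first by exists k, l.
move=> x y x' y' i j dxy vx.
have girth c : graph_cycle e c -> 2 * diameter e - 2 <= size c.
  rewrite hd; case: g hg hgd => [m [_ m_min] dm|acyclic _] cyc.
    exact: leq_trans dm (m_min c cyc).
  by case: (acyclic c cyc).
rewrite -hd in heig.
apply: (sphere_meet_dist (semiregular_sym hG) hconn (bipartite_edge hG)
  (valency_dist hG hconn)) => // u w u' w' m.
exact: (nbrs_at_dist hG hconn m girth heig).
Qed.
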